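(* Let $X$ be a finite set and let $(x,y)\mapsto(\sigma_x(y),\tau_y(x))$ be a non-degenerate set-theoretic solution of the braid equation on $X$ (not necessarily involutive). Let $V=\mathbb{C}X$, and let $$\check r=\sum_{x,y\in X}e_{x,\sigma_x(y)}\otimes e_{y,\tau_y(x)}\in\mathrm{End}(V\otimes V),\qquad \check r_{12}=\check r\otimes\mathrm{id},\quad \check r_{23}=\mathrm{id}\otimes\check r .$$ Define the following elements of $\mathrm{End}(V\otimes V\otimes V)$: $$F_{1,23}=\sum_{x,y,\eta\in X}e_{\eta,\eta}\otimes e_{\sigma_\eta(x),x}\otimes e_{\sigma_{\tau_x(\eta)}(y),y},\qquad F^*_{12,3}=\sum_{x,y,\eta\in X}e_{\eta,\eta}\otimes e_{x,x}\otimes e_{\sigma_\eta(\sigma_x(y)),y},$$ $$\hat F^*_{1,23}=\sum_{x,y,\eta\in X}e_{\tau_y(\tau_x(\eta)),\eta}\otimes e_{x,x}\otimes e_{y,y},\qquad \hat F_{12,3}=\sum_{x,y,\eta\in X}e_{\tau_{\sigma_x(y)}(\eta),\eta}\otimes e_{\tau_y(x),x}\otimes e_{y,y}.$$ Then $$\check r_{12}F^*_{12,3}=F^*_{12,3}\check r_{12},\quad \check r_{23}F_{1,23}=F_{1,23}\check r_{23},\quad \check r_{12}\hat F_{12,3}=\hat F_{12,3}\check r_{12},\quad \check r_{23}\hat F^*_{1,23}=\hat F^*_{1,23}\check r_{23}.$$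
   Context: $V=\mathbb{C}X$ is the vector space with basis $\{e_x\}_{x\in X}$, and $e_{x,y}\in\mathrm{End}(V)$ is the matrix unit with $e_{x,y}e_w=\delta_{y,w}e_x$. A map $X\times X\to X\times X$, $(x,y)\mapsto(\sigma_x(y),\tau_y(x))$, is a set-theoretic solution of the braid equation if it satisfies $(\check s\times\mathrm{id})(\mathrm{id}\times\check s)(\check s\times\mathrm{id})=(\mathrm{id}\times\check s)(\check s\times\mathrm{id})(\mathrm{id}\times\check s)$ (with $\check s$ the map); equivalently, for all $\eta,x,y\in X$: $\sigma_\eta(\sigma_x(y))=\sigma_{\sigma_\eta(x)}(\sigma_{\tau_x(\eta)}(y))$, $\tau_y(\tau_x(\eta))=\tau_{\tau_y(x)}(\tau_{\sigma_x(y)}(\eta))$, and $\tau_{\sigma_{\tau_x(\eta)}(y)}(\sigma_\eta(x))=\sigma_{\tau_{\sigma_x(y)}(\eta)}(\tau_y(x))$. It is non-degenerate if all $\sigma_x$ and $\tau_y$ are bijections of $X$. *)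

(* Defs.v *)
From HB Require Import structures.
From mathcomp Require Import all_boot all_order all_algebra.
From mathcomp Require Import reals.
From mathcomp.real_closed Require Import complex mxtens.

Set Implicit Arguments.
Unset Strict Implicit.
Unset Printing Implicit Defensive.

Import GRing.Theory.
Local Open Scope ring_scope.

Section SetTheoreticSolution.
Variable X : Type.
Implicit Types s : X * X -> X * X.

Definition act12 s (p : X * X * X) : X * X * X := (s p.1, p.2).

Definition act23 s (p : X * X * X) : X * X * X :=
  let q := s (p.1.2, p.2) in (p.1.1, q.1, q.2).

Definition braid_equation s :=
  forall p, act12 s (act23 s (act12 s p)) = act23 s (act12 s (act23 s p)).

(* [sigma x y] is $\sigma_x(y)$ and [tau y x] is $\tau_y(x)$: in both cases
   the first argument is the subscript. *)
Definition sol_map (sigma tau : X -> X -> X) (p : X * X) : X * X :=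
  (sigma p.1 p.2, tau p.2 p.1).

Definition nondegenerate_sol (sigma tau : X -> X -> X) :=
  (forall x, bijective (sigma x)) /\ (forall y, bijective (tau y)).

End SetTheoreticSolution.

(* Operators are written as matrices acting on columns, the basis (e_x) of
   $V = \mathbb{C}X$ being indexed by 'I_#|X| through [enum_rank]. Thus End(V)
   is 'M_#|X|, composition is [*m], and the tensor product of operators is the
   Kronecker product [*t]. *)
Section Operators.
Variables (R : realType) (X : finType).
Local Notation C := R[i].
Local Notation n := #|X|.

Definition ebasis (x : X) : 'cV[C]_n := delta_mx (enum_rank x) 0.

Definition eunit (x y : X) : 'M[C]_n := delta_mx (enum_rank x) (enum_rank y).

Lemma eunit_ebasis x y w :
  eunit x y *m ebasis w = if y == w then ebasis x else 0.
Proof.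
rewrite /eunit /ebasis mul_delta_mx_cond (inj_eq enum_rank_inj).
by case: eqP.
Qed.

(* End(V (x) V (x) V) is 'M_(n * n * n), with tensors bracketed to the left;
   an operator A (x) B with B in End(V (x) V) lives in 'M_(n * (n * n)) and is
   transported along the associativity of the tensor product, which on indices
   is the cast along [mulnA] (see [assoc_tensmx]). *)
Definition assoc3 (M : 'M[C]_(n * (n * n))) : 'M[C]_(n * n * n) :=
  castmx (mulnA n n n, mulnA n n n) M.

Lemma assoc_tensmx (A B D : 'M[C]_n) : assoc3 (A *t (B *t D)) = A *t B *t D.
Proof.
apply/matrixP=> i j; rewrite castmxE.
case: (mxtens_indexP i) => i12 i3; case: (mxtens_indexP i12) => i1 i2.
case: (mxtens_indexP j) => j12 j3; case: (mxtens_indexP j12) => j1 j2.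
have assoc_index a b c : cast_ord (esym (mulnA n n n))
    (mxtens_index (mxtens_index (a, b), c))
    = mxtens_index (a, mxtens_index (b, c)).
  by apply: val_inj; rewrite /= mulnDl mulnA addnA.
by rewrite !assoc_index !tensmxE mulrA.
Qed.

Definition op12 (M : 'M[C]_(n * n)) : 'M[C]_(n * n * n) := M *t 1%:M.

Definition op23 (M : 'M[C]_(n * n)) : 'M[C]_(n * n * n) := assoc3 (1%:M *t M).

Variables sigma tau : X -> X -> X.

Definition rcheck : 'M[C]_(n * n) :=
  \sum_(x : X) \sum_(y : X) eunit x (sigma x y) *t eunit y (tau y x).

Definition F_1_23 : 'M[C]_(n * n * n) :=
  \sum_(x : X) \sum_(y : X) \sum_(eta : X)
    eunit eta eta *t eunit (sigma eta x) x
      *t eunit (sigma (tau x eta) y) y.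

Definition Fstar_12_3 : 'M[C]_(n * n * n) :=
  \sum_(x : X) \sum_(y : X) \sum_(eta : X)
    eunit eta eta *t eunit x x *t eunit (sigma eta (sigma x y)) y.

Definition Fhatstar_1_23 : 'M[C]_(n * n * n) :=
  \sum_(x : X) \sum_(y : X) \sum_(eta : X)
    eunit (tau y (tau x eta)) eta *t eunit x x *t eunit y y.

Definition Fhat_12_3 : 'M[C]_(n * n * n) :=
  \sum_(x : X) \sum_(y : X) \sum_(eta : X)
    eunit (tau (sigma x y) eta) eta *t eunit (tau y x) x *t eunit y y.

End Operators.

(* Main.v *)
Require Import Defs.
From mathcomp Require Import all_boot all_order all_algebra.
From mathcomp Require Import reals.
From mathcomp.real_closed Require Import complex mxtens.

(** Each of the four twists permutes the basis of $V^{\otimes 3}$: it is the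
    operator $e_p \mapsto e_{f(p)}$ of an explicit map $f$ of $X^3$, injective
    because all $\sigma_x$ and $\tau_y$ are ([Fstar_map_inj] and its three
    analogues). The operator $\check r_{12}$ (or $\check r_{23}$), on the other
    hand, is $\sum_p e_{p,g(p)}$, the transpose of the operator of
    $g = \check s \times \mathrm{id}$ (or $\mathrm{id} \times \check s$).

    When $f \circ g = g \circ f$, the operator of $f$ commutes with that of $g$;
    as it is a permutation matrix, its inverse is its transpose, so it also
    commutes with the transpose of the operator of $g$
    ([commute_map_pullback]). In each of the four cases $f \circ g = g \circ f$
    is read off from one or two of the three components of the braid equation
    ([braid_components]). *)

Set Implicit Arguments.
Unset Strict Implicit.
Unset Printing Implicit Defensive.

Import GRing.Theory.
Local Open Scope ring_scope.

Lemma tensmx_suml (K : pzRingType) (I : finType) m1 n1 m2 n2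
    (A : I -> 'M[K]_(m1, n1)) (B : 'M[K]_(m2, n2)) :
  (\sum_i A i) *t B = \sum_i (A i *t B).
Proof.
apply/matrixP => i j; case: (mxtens_indexP i) => i1 i2.
case: (mxtens_indexP j) => j1 j2; rewrite tensmxE !summxE mulr_suml.
by apply: eq_bigr => k _; rewrite tensmxE.
Qed.

Lemma tensmx_sumr (K : pzRingType) (I : finType) m1 n1 m2 n2
    (A : 'M[K]_(m1, n1)) (B : I -> 'M[K]_(m2, n2)) :
  A *t (\sum_i B i) = \sum_i (A *t B i).
Proof.
apply/matrixP => i j; case: (mxtens_indexP i) => i1 i2.
case: (mxtens_indexP j) => j1 j2; rewrite tensmxE !summxE mulr_sumr.
by apply: eq_bigr => k _; rewrite tensmxE.
Qed.

Section TripleOperators.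
Variables (R : realType) (X : finType).
Local Notation C := R[i].
Local Notation n := #|X|.
Implicit Types (p q : X * X * X) (f g : X * X * X -> X * X * X).

Definition eunit3 p q : 'M[C]_(n * n * n) :=
  eunit R p.1.1 q.1.1 *t eunit R p.1.2 q.1.2 *t eunit R p.2 q.2.

Definition map_op f : 'M[C]_(n * n * n) := \sum_p eunit3 (f p) p.

(** The transpose of [map_op g]; on functions on $X^3$ it is composition
    with $g$. *)
Definition pullback_op g : 'M[C]_(n * n * n) := \sum_p eunit3 p (g p).

Lemma mul_eunit x y z w :
  eunit R x y *m eunit R z w = if y == z :> X then eunit R x w else 0.
Proof.
by rewrite /eunit mul_delta_mx_cond (inj_eq enum_rank_inj); case: eqP.
Qed.

Lemma mul_eunit3 p q p' q' :
  eunit3 p q *m eunit3 p' q' = if q == p' then eunit3 p q' else 0.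
Proof.
case: q p' => [[q1 q2] q3] [[p1 p2] p3].
rewrite /eunit3 /= !tensmx_mul !mul_eunit !xpair_eqE.
by do 3!case: eqP => _ /=; rewrite ?tensmx0 ?tens0mx.
Qed.

(** After the substitution $p = f(p')$, the product on the left only keeps the
    pairs $(p', q)$ with $f(q) = g(f(p')) = f(g(p'))$, that is $q = g(p')$; both
    sides are then $\sum_p e_{f(p),g(p)}$. *)
Lemma commute_map_pullback f g :
    injective f -> (forall p, g (f p) = f (g p)) ->
  pullback_op g *m map_op f = map_op f *m pullback_op g.
Proof.
move=> f_inj fgC; transitivity (\sum_p eunit3 (f p) (g p)).
  rewrite /pullback_op (reindex_inj f_inj) mulmx_suml; apply: eq_bigr => p _.
  rewrite mulmx_sumr (bigD1 (g p)) //= mul_eunit3 fgC eqxx big1 ?addr0 // => q.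
  by rewrite mul_eunit3 (inj_eq f_inj) eq_sym => /negPf->.
rewrite mulmx_suml; apply: eq_bigr => p _.
rewrite mulmx_sumr (bigD1 p) //= mul_eunit3 eqxx big1 ?addr0 // => q.
by rewrite mul_eunit3 eq_sym => /negPf->.
Qed.

Lemma scalar1_eunit : 1%:M = \sum_(x : X) eunit R x x.
Proof.
rewrite (reindex (@enum_val X predT)) /=; last first.
  by apply: onW_bij; apply: enum_val_bij.
apply/matrixP => i j; rewrite summxE mxE (bigD1 i) //= big1 => [|k].
  by rewrite /eunit mxE enum_valK eqxx eq_sym addr0.
by rewrite eq_sym /eunit mxE enum_valK => /negPf->.
Qed.

Lemma assoc3_sum (I : finType) (M : I -> 'M[C]_(n * (n * n))) :
  assoc3 (\sum_i M i) = \sum_i assoc3 (M i).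
Proof.
apply/matrixP => i j; rewrite castmxE !summxE.
by apply: eq_bigr => k _; rewrite castmxE.
Qed.

Lemma sum_triple (A : X * X * X -> 'M[C]_(n * n * n)) :
  \sum_p A p = \sum_x \sum_y \sum_z A (x, y, z).
Proof.
by rewrite pair_bigA pair_bigA /=; apply: eq_bigr => -[[x y] z] _.
Qed.

Variables sigma tau : X -> X -> X.
Local Notation s := (sol_map sigma tau).

Lemma op12_rcheck : op12 (rcheck R sigma tau) = pullback_op (act12 s).
Proof.
rewrite /op12 /rcheck /pullback_op sum_triple tensmx_suml.
apply: eq_bigr => x _; rewrite tensmx_suml; apply: eq_bigr => y _.
by rewrite scalar1_eunit tensmx_sumr.
Qed.

Lemma op23_rcheck : op23 (rcheck R sigma tau) = pullback_op (act23 s).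
Proof.
rewrite /op23 /rcheck /pullback_op sum_triple scalar1_eunit tensmx_suml.
rewrite assoc3_sum; apply: eq_bigr => x _.
rewrite tensmx_sumr assoc3_sum; apply: eq_bigr => y _.
rewrite tensmx_sumr assoc3_sum; apply: eq_bigr => z _.
by rewrite assoc_tensmx.
Qed.

Lemma map_op_sum f :
  map_op f = \sum_x \sum_y \sum_eta eunit3 (f (eta, x, y)) (eta, x, y).
Proof.
rewrite /map_op sum_triple exchange_big; apply: eq_bigr => x _.
by rewrite exchange_big.
Qed.

Definition Fstar_map p := (p.1.1, p.1.2, sigma p.1.1 (sigma p.1.2 p.2)).

Definition F_map p :=
  (p.1.1, sigma p.1.1 p.1.2, sigma (tau p.1.2 p.1.1) p.2).

Definition Fhat_map p :=
  (tau (sigma p.1.2 p.2) p.1.1, tau p.2 p.1.2, p.2).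

Definition Fhatstar_map p := (tau p.2 (tau p.1.2 p.1.1), p.1.2, p.2).

Lemma Fstar_map_op : Fstar_12_3 R sigma = map_op Fstar_map.
Proof. by rewrite map_op_sum. Qed.

Lemma F_map_op : F_1_23 R sigma tau = map_op F_map.
Proof. by rewrite map_op_sum. Qed.

Lemma Fhat_map_op : Fhat_12_3 R sigma tau = map_op Fhat_map.
Proof. by rewrite map_op_sum. Qed.

Lemma Fhatstar_map_op : Fhatstar_1_23 R tau = map_op Fhatstar_map.
Proof. by rewrite map_op_sum. Qed.

Section Injectivity.
Hypotheses (sigma_inj : forall x, injective (sigma x))
           (tau_inj : forall y, injective (tau y)).

Lemma Fstar_map_inj : injective Fstar_map.
Proof.
by move=> [[a b] c] [[a' b'] c'] [-> -> /sigma_inj/sigma_inj->].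
Qed.

(** The maps [F_map] and [Fhat_map] are triangular: each coordinate, taken in
    the right order, is moved by a bijection depending only on coordinates
    already recovered. *)
Lemma F_map_inj : injective F_map.
Proof.
by move=> [[a b] c] [[a' b'] c'] [-> /sigma_inj-> /sigma_inj->].
Qed.

Lemma Fhat_map_inj : injective Fhat_map.
Proof.
move=> [[a b] c] [[a' b'] c'] [/= Ea Eb Ec]; subst c'.
by move/tau_inj: Eb Ea => -> /tau_inj->.
Qed.

Lemma Fhatstar_map_inj : injective Fhatstar_map.
Proof.
move=> [[a b] c] [[a' b'] c'] [/= Ea Eb Ec].
by move: Ea; rewrite Eb Ec => /tau_inj/tau_inj->.
Qed.

End Injectivity.

Section Commutation.
Hypothesis hbraid : braid_equation s.

Lemma braid_components eta x y :
  [/\ sigma (sigma eta x) (sigma (tau x eta) y) = sigma eta (sigma x y),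
      tau (sigma (tau x eta) y) (sigma eta x)
        = sigma (tau (sigma x y) eta) (tau y x)
    & tau y (tau x eta) = tau (tau y x) (tau (sigma x y) eta)].
Proof. by case: (hbraid (eta, x, y)). Qed.

Lemma act12_Fstar_map p : act12 s (Fstar_map p) = Fstar_map (act12 s p).
Proof.
case: p => [[eta x] y]; have [E _ _] := braid_components eta x y.
by rewrite /act12 /Fstar_map /= E.
Qed.

Lemma act23_F_map p : act23 s (F_map p) = F_map (act23 s p).
Proof.
case: p => [[eta x] y]; have [E1 E2 _] := braid_components eta x y.
by rewrite /act23 /F_map /= E1 E2.
Qed.

Lemma act12_Fhat_map p : act12 s (Fhat_map p) = Fhat_map (act12 s p).
Proof.
case: p => [[eta x] y]; have [_ E2 E3] := braid_components eta x y.
by rewrite /act12 /Fhat_map /sol_map /= E2 E3.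
Qed.

Lemma act23_Fhatstar_map p :
  act23 s (Fhatstar_map p) = Fhatstar_map (act23 s p).
Proof.
case: p => [[eta x] y]; have [_ _ E3] := braid_components eta x y.
by rewrite /act23 /Fhatstar_map /= E3.
Qed.

End Commutation.
End TripleOperators.

Theorem proposition4p5 (R : realType) (X : finType) (sigma tau : X -> X -> X)
    (hbraid : braid_equation (sol_map sigma tau))
    (hnondeg : nondegenerate_sol sigma tau) :
  [/\ op12 (rcheck R sigma tau) *m Fstar_12_3 R sigma
        = Fstar_12_3 R sigma *m op12 (rcheck R sigma tau),
      op23 (rcheck R sigma tau) *m F_1_23 R sigma tau
        = F_1_23 R sigma tau *m op23 (rcheck R sigma tau),
      op12 (rcheck R sigma tau) *m Fhat_12_3 R sigma tau
        = Fhat_12_3 R sigma tau *m op12 (rcheck R sigma tau)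
    & op23 (rcheck R sigma tau) *m Fhatstar_1_23 R tau
        = Fhatstar_1_23 R tau *m op23 (rcheck R sigma tau)]%R.
Proof.
have sigma_inj x : injective (sigma x) by apply: bij_inj; apply: hnondeg.1.
have tau_inj y : injective (tau y) by apply: bij_inj; apply: hnondeg.2.
rewrite op12_rcheck op23_rcheck (Fstar_map_op R sigma) F_map_op Fhat_map_op.
rewrite Fhatstar_map_op; split; apply: commute_map_pullback.
- exact: Fstar_map_inj.
- exact: act12_Fstar_map.
- exact: F_map_inj.
- exact: act23_F_map.
- exact: Fhat_map_inj.
- exact: act12_Fhat_map.
- exact: Fhatstar_map_inj.
- exact: act23_Fhatstar_map.
Qed.
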